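(* Let $d\ge 2$ and let $\varphi=\sum_{i=0}^{d-1}\alpha_i e_i\otimes e_i\in\mathbb{C}^d\otimes\mathbb{C}^d$, where $\alpha_0\ge\cdots\ge\alpha_{d-1}>0$ and $\sum_{i=0}^{d-1}\alpha_i^2=1$. Let $\mathcal{M}\subseteq\mathcal{B}(\mathcal{H})$ be a non-degenerate von Neumann algebra and let $\psi\in\mathcal{H}$ be a unit vector. Let $\omega=\langle(\cdot)\psi,\psi\rangle$ be the marginal of $\psi$ on $\mathcal{M}$ with support projection $P$, and let $R\in M_d\otimes\mathcal{M}$ be a contraction. The following statements are equivalent: (1) $(R,\psi)$ exactly embezzles $\varphi$ in $(\mathcal{M},\mathcal{H})$. (2) The operators $V_i=PR_{i0}^*P$, $i=0,\dots,d-1$, form a collection of $d$ Cuntz isometries in $P\mathcal{M}P$ satisfying $\omega(V_iXV_j^* )=\delta_{ij}\alpha_i^2\omega(X)$ for all $X\in\mathcal{M}$ and $i,j=0,\dots,d-1$.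
   Context: $\{e_0,\dots,e_{d-1}\}$ is the canonical orthonormal basis of $\mathbb{C}^d$. Write $R=\sum_{i,j=0}^{d-1}E_{ij}\otimes R_{ij}$ with $R_{ij}\in\mathcal{M}$, $E_{ij}$ the matrix units. $(R,\psi)$ exactly embezzles $\varphi$ in $(\mathcal{M},\mathcal{H})$ (monopartite) if $R\in M_d\otimes\mathcal{M}$ is a contraction, $\psi$ is a unit vector and $\omega(R_{i0}^*XR_{j0})=\delta_{ij}\alpha_i^2\omega(X)$ for all $X\in\mathcal{M}$ and $i,j=0,\dots,d-1$. The support projection of $\omega$ on $\mathcal{M}$ is $P=1-\sup\{X\in\mathcal{M}: X^2=X=X^*,\ \omega(X)=0\}$. Operators $V_0,\dots,V_{d-1}$ in $P\mathcal{M}P$ (a von Neumann algebra on $P\mathcal{H}$ with unit $P$) form a collection of $d$ Cuntz isometries if $V_j^*V_j=P$ for all $j$ and $\sum_{i=0}^{d-1}V_iV_i^*=P$. *)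

(* Defs.v *)
From HB Require Import structures.
From mathcomp Require Import all_boot all_order all_algebra sesquilinear complex.
From mathcomp Require Import boolp classical_sets functions reals.
From mathcomp Require Import topology normedtype.
Set Implicit Arguments.
Unset Strict Implicit.
Unset Printing Implicit Defensive.
Import Order.TTheory GRing.Theory Num.Theory.
Import numFieldNormedType.Exports.
Local Open Scope classical_set_scope.
Local Open Scope ring_scope.
Local Open Scope complex_scope.

(* The form [inner] is linear in its first argument and conjugate-linear in
   its second one.                                                            *)
HB.mixin Record isHilbert (R : realType) H
    of CompleteNormedModule R[i] H := {
  inner : {dot H for Num.conj} ;
  inner_norm : forall x : H, `|x| ^+ 2 = inner x x }.

#[short(type="hilbertType")]
HB.structure Definition Hilbert (R : realType) :=
  { H of isHilbert R H & CompleteNormedModule R[i] H }.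

Section Operators.
Context {R : realType} {H : hilbertType R}.
Implicit Types (A P Q T X Y : H -> H) (M S : set (H -> H)) (psi : H).

Definition bounded_op : set (H -> H) :=
  [set T | linear T /\ exists c : R[i], forall x, `|T x| <= c * `|x|].

(* [adjoint T y] is the vector z such that <T x, y> = <x, z> for all x; it
   exists, by the Riesz representation theorem, and is unique when T is a
   bounded operator.                                                          *)
Definition adjoint T : H -> H :=
  fun y => xget 0 [set z | forall x, inner (T x) y = inner x z].

Definition commutant S : set (H -> H) :=
  [set T | bounded_op T /\ forall A, S A -> T \o A = A \o T].

(* A unital *-subalgebra of B(H) that is equal to its bicommutant. The identity
   of B(H) belongs to M, that is, M acts non-degenerately on H.               *)
Record von_neumann_algebra M : Prop := {
  vna_bounded : M `<=` bounded_op ;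
  vna_id : M idfun ;
  vna_add : forall A T, M A -> M T -> M (A + T) ;
  vna_scale : forall (c : R[i]) A, M A -> M (c *: A) ;
  vna_mul : forall A T, M A -> M T -> M (A \o T) ;
  vna_adjoint : forall A, M A -> M (adjoint A) ;
  vna_bicommutant : commutant (commutant M) = M }.

Definition marginal psi (X : H -> H) : R[i] := inner (X psi) psi.

Definition projections M : set (H -> H) :=
  [set X | [/\ M X, X \o X = X & adjoint X = X]].

(* The order on R[i] used here holds only between numbers with the same
   imaginary part, so this is the positivity of Y - X.                        *)
Definition op_le X Y : Prop := forall x, inner (X x) x <= inner (Y x) x.

(* Supremum in the lattice of projections of M. *)
Definition is_projection_sup M S Q : Prop :=
  [/\ projections M Q,
      forall X, S X -> op_le X Q
    & forall Y, projections M Y -> (forall X, S X -> op_le X Y) -> op_le Q Y].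

Definition is_support_projection M (omega : (H -> H) -> R[i]) P : Prop :=
  exists2 Q, is_projection_sup M (projections M `&` [set X | omega X = 0]) Q
           & P = idfun - Q.

Definition corner M P : set (H -> H) := [set P \o X \o P | X in M].

(* M_d (x) M is identified with the d x d matrices over M: the matrix Rm stands
   for \sum_(i, j) E_ij (x) Rm i j, and acts on C^d (x) H, identified with the
   Hilbert sum of d copies of H.                                              *)
Definition matrix_over M d (Rm : 'M[H -> H]_d) : Prop :=
  forall i j, M (Rm i j).

Definition block_contraction d (Rm : 'M[H -> H]_d) : Prop :=
  forall x : 'I_d -> H,
    \sum_(i < d) `|\sum_(j < d) Rm i j (x j)| ^+ 2 <= \sum_(j < d) `|x j| ^+ 2.

(* (Rm, psi) exactly embezzles \sum_(i < d) alpha_i e_i (x) e_i. *)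
Definition exactly_embezzles M d (d_gt0 : (0 < d)%N) (Rm : 'M[H -> H]_d) psi
    (alpha : 'I_d -> R) : Prop :=
  [/\ matrix_over M Rm, block_contraction Rm, `|psi| = 1
    & forall X, M X -> forall i j : 'I_d,
        let o := Ordinal d_gt0 in
        marginal psi (adjoint (Rm i o) \o X \o Rm j o) =
        (i == j)%:R * (alpha i)%:C ^+ 2 * marginal psi X].

Definition cuntz_isometries M P d (V : 'I_d -> H -> H) : Prop :=
  [/\ forall i, corner M P (V i),
      forall j, adjoint (V j) \o V j = P
    & \sum_(i < d) (V i \o adjoint (V i)) = P].

End Operators.

(* Main.v *)
(* The support projection P of omega is the projection onto the vectors killed
   by every X in M with X psi = 0; hence P fixes psi, and X psi = 0 forces
   X P = 0. Write T_i = R_(i 0) and A' for the adjoint of A.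

   If R embezzles, omega(T_i' (1 - P) T_i) = 0, so T_i maps the range of P into
   itself, and sum_i omega(T_i' T_i) = sum_i alpha_i^2 = 1 forces
   sum_i T_i' T_i P = P because R is a contraction. With W_i = P T_i P,
   orthogonality and sum_j W_j' W_j = P give alpha_i^2 = omega((W_i' W_i)^2)
   = alpha_i^2 omega(W_i W_i'), so omega(W_i W_i') = 1 and W_i W_i' = P.

   Conversely, sum_i |P T_i P x|^2 = |P x|^2 >= sum_i |T_i P x|^2 forces
   T_i P = P T_i P, so that T_i psi = V_i' psi. *)
Require Import Defs.
From HB Require Import structures.
From mathcomp Require Import all_boot all_order all_algebra sesquilinear complex.
From mathcomp Require Import boolp classical_sets functions reals.
From mathcomp Require Import topology normedtype.
From mathcomp Require Import ring lra.
Import Order.TTheory GRing.Theory Num.Theory.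
Import numFieldNormedType.Exports.
Local Open Scope classical_set_scope.
Local Open Scope ring_scope.
Local Open Scope complex_scope.

(** * Inner product identities and the Cauchy-Schwarz inequality *)

Section InnerProduct.
Context {R : realType} {H : hilbertType R}.
Implicit Types (x y z u : H) (a : R[i]) (T S : H -> H).

Lemma innerDl x y z : inner (x + y) z = inner x z + inner y z.
Proof. exact: linearDl. Qed.

Lemma innerBl x y z : inner (x - y) z = inner x z - inner y z.
Proof. exact: linearBl. Qed.

Lemma innerZl a x z : inner (a *: x) z = a * inner x z.
Proof. exact: linearZl_LR. Qed.

Lemma inner0l z : inner 0 z = 0 :> R[i].
Proof. exact: linear0l. Qed.

Lemma innerC x y : inner x y = Num.conj (inner y x).
Proof. by rewrite hermC /= expr0 mul1r. Qed.

Lemma innerDr x y z : inner x (y + z) = inner x y + inner x z.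
Proof. exact: linearDr. Qed.

Lemma innerBr x y z : inner x (y - z) = inner x y - inner x z.
Proof. exact: linearBr. Qed.

Lemma inner0r x : inner x 0 = 0 :> R[i].
Proof. exact: linear0r. Qed.

Lemma innerZr a x z : inner x (a *: z) = Num.conj a * inner x z.
Proof. by rewrite innerC innerZl rmorphM /= [in RHS]innerC. Qed.

Lemma inner_suml I (r : seq I) (Q : pred I) (F : I -> H) z :
  inner (\sum_(i <- r | Q i) F i) z = \sum_(i <- r | Q i) inner (F i) z.
Proof. exact: (linear_sumlz inner). Qed.

Lemma inner_eq0 x : inner x x = 0 -> x = 0.
Proof. by rewrite -inner_norm => /eqP; rewrite expf_eq0 normr_eq0 => /eqP. Qed.

Lemma inner_inj x y : (forall z, inner x z = inner y z) -> x = y.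
Proof.
by move=> xy; apply/eqP; rewrite -subr_eq0; apply/eqP/inner_eq0;
  rewrite innerBl xy subrr.
Qed.

Lemma sqrnormD x y :
  `|x + y| ^+ 2 = `|x| ^+ 2 + `|y| ^+ 2 + (inner x y + inner y x).
Proof.
by rewrite !inner_norm !(innerDl, innerDr); ring.
Qed.

Lemma sqrnormB x y :
  `|x - y| ^+ 2 = `|x| ^+ 2 + `|y| ^+ 2 - (inner x y + inner y x).
Proof. by rewrite !inner_norm !(innerBl, innerBr); ring. Qed.

Lemma parallelogram x y :
  `|x + y| ^+ 2 + `|x - y| ^+ 2 = (`|x| ^+ 2 + `|y| ^+ 2) *+ 2.
Proof. by rewrite sqrnormD sqrnormB addrACA subrr addr0 mulr2n. Qed.

Lemma pythagoras x y : inner x y = 0 -> `|x + y| ^+ 2 = `|x| ^+ 2 + `|y| ^+ 2.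
Proof. by move=> xy; rewrite sqrnormD xy (innerC y) xy rmorph0 !addr0. Qed.

(** The subtracted multiple is the orthogonal projection of [x] on the line of [y]. The gain on the
    right gives both Cauchy-Schwarz and the orthogonality property of nearest points. *)
Lemma sqrnorm_sub_line x y : y != 0 ->
  `|x - (inner x y / `|y| ^+ 2) *: y| ^+ 2 =
  `|x| ^+ 2 - `|inner x y| ^+ 2 / `|y| ^+ 2.
Proof.
move=> y0; set c := inner x y.
have ny0 : `|y| ^+ 2 != 0 by rewrite expf_eq0 normr_eq0.
have nyR : Num.conj (`|y| ^+ 2) = `|y| ^+ 2.
  by apply: CrealP; rewrite rpredX // normr_real.
rewrite sqrnormB (inner_norm (_ *: y)) !(innerZl, innerZr) (innerC y x) -/c.
rewrite -inner_norm rmorphM fmorphV /= nyR normCK.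
by field; rewrite normr_eq0.
Qed.

Lemma cauchy_schwarz x y : `|inner x y| <= `|x| * `|y|.
Proof.
have [->|y0] := eqVneq y 0; first by rewrite inner0r !normr0 mulr0.
rewrite -(@ler_pXn2r _ 2) // ?nnegrE ?mulr_ge0 //.
rewrite exprMn -ler_pdivrMr ?exprn_gt0 ?normr_gt0 //.
by rewrite -subr_ge0 -sqrnorm_sub_line // exprn_ge0.
Qed.

End InnerProduct.

(** * The projection theorem for closed subspaces *)

Section OrthogonalProjection.
Context {R : realType} {H : hilbertType R}.
Implicit Types (x y k : H) (K : set H) (T : H -> H).

Definition closed_subspace K : Prop :=
  [/\ K 0, forall (a : R[i]) x y, K x -> K y -> K (a *: x + y)
    & forall x,
      (forall e : R[i], 0 < e -> exists2 k, K k & `|x - k| < e) -> K x].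

(** A minimizing sequence in [K] is Cauchy by the parallelogram identity, and its limit attains the
    infimum of the distances. *)
Lemma nearest_point K x : closed_subspace K ->
  exists2 k0, K k0 & forall k, K k -> `|x - k0| <= `|x - k|.
Proof.
move=> [K0 Klin Kcl].
(* Norms take values in [R[i]]; their real parts live in the ordered field [R], where the infimum is
   taken. *)
pose r y : R := complex.Re `|y|.
have rE y : `|y| = (r y)%:C by rewrite RRe_real // normr_real.
have r_ge0 y : 0 <= r y by rewrite -lecR -rE normr_ge0.
pose E := [set r (x - k) ^+ 2 | k in K].
have E_lb : has_lbound E by exists 0 => _ [k _ <-]; exact: sqr_ge0.
have E_inf : has_inf E by split => //; exists (r (x - 0) ^+ 2), 0.
pose m := inf E.
have mP k : K k -> m <= r (x - k) ^+ 2.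
  by move=> Kk; apply: ge_inf => //; exists k.
have /choice [u uP] (n : nat) :
    exists k, K k /\ r (x - k) ^+ 2 < m + n.+1%:R^-1.
  have [|_ [k Kk <-] lt_k] := @inf_adherent _ E n.+1%:R^-1 _ E_inf.
    by rewrite invr_gt0.
  by exists k.
(* Parallelogram identity for [x - l] and [x - k]: their sum is twice [x - mid], and the midpoint of
   [k] and [l] lies in [K], so its squared distance to [x] is at least [m]. *)
have dist_u k l : K k -> K l ->
    r (k - l) ^+ 2 <= 2 * (r (x - k) ^+ 2 - m) + 2 * (r (x - l) ^+ 2 - m).
  move=> Kk Kl.
  have := parallelogram (x - l) (x - k).
  have -> : x - l - (x - k) = k - l by rewrite opprB addrC addrA subrK.
  pose mid := 2^-1 *: k + (2^-1 *: l + 0).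
  have Kmid : K mid by apply: (Klin) => //; apply: (Klin).
  have -> : x - l + (x - k) = (2 : R[i]) *: (x - mid).
    rewrite /mid addr0 -scalerDr scalerBr scalerA divff ?pnatr_eq0 // scale1r.
    by rewrite scaler_nat mulr2n opprD addrACA [- l - k]addrC.
  rewrite normrZ !rE ger0_norm // -(rmorph_nat (real_complex R) 2) -rmorphM.
  rewrite -!rmorphXn -!rmorphD -rmorphMn => -[].
  have := mP _ Kmid.
  move: (r _) (r _) (r _) (r _) => a b c e; rewrite exprMn mulr2n; lra.
have small (e : R) :
    0 < e -> exists n0, forall n, (n0 <= n)%N -> n.+1%:R^-1 < e.
  move=> e0; exists (Num.truncn e^-1) => n; rewrite truncn_le_nat => lt_n.
  by rewrite invf_plt ?posrE.
have u_cvg : cvg (u @ \oo).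
  apply/cauchy_cvgP/cauchy_exP => e e0.
  have eE : e = (complex.Re e)%:C by rewrite RRe_real // gtr0_real.
  move: e0; rewrite eE; move: (complex.Re e) => {eE}e; rewrite ltcR => e0.
  (* Each of the two terms of [dist_u] is then below [e ^+ 2 / 2]. *)
  have [n0 n0P] := small (e ^+ 2 / 4) ltac:(by rewrite divr_gt0 // exprn_gt0).
  exists (u n0); exists n0 => // n /= le_n.
  rewrite -ball_normE /ball_ /= rE ltcR -(@ltr_pXn2r _ 2) // ?nnegrE // ?ltW //.
  have [Kn ltn] := uP n; have [Kn0 ltn0] := uP n0.
  have := dist_u _ _ Kn0 Kn; have := n0P _ le_n; have := n0P _ (leqnn n0).
  move: (_^-1) (_^-1) ltn ltn0 => a b; lra.
move/cvgrPdist_lt in u_cvg.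
set l := lim (u @ \oo) in u_cvg.
exists l.
  apply: Kcl => e /u_cvg [n _ /(_ _ (leqnn n)) /= lt_e].
  by exists (u n) => //; case: (uP n).
move=> k Kk; rewrite !rE lecR.
suff near_min (e : R) : 0 < e -> r (x - l) <= r (x - k) + e.
  exact/ler_addgt0Pr.
move=> e0.
have e2 : 0 < e / 2 by rewrite divr_gt0.
have [n1 _ n1P] := u_cvg (e / 2)%:C ltac:(by rewrite ltcR).
have [n0 n0P] := small ((e / 2) ^+ 2) ltac:(by rewrite exprn_gt0).
pose n := maxn n0 n1; have := n1P n (leq_maxr _ _); rewrite /= rE ltcR => lt_l.
have [Kn ltn] := uP n.
have le1 : r (x - u n) <= r (x - k) + e / 2.
  rewrite -(@ler_pXn2r _ 2) // ?nnegrE ?addr_ge0 ?(ltW e2) // sqrrD -mulr_natr.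
  have := mP _ Kk; have := n0P n (leq_maxl _ _).
  have := mulr_ge0 (r_ge0 (x - k)) (ltW e2).
  by move: ltn; move: (e / 2) (n.+1%:R^-1) => f i; lra.
have : r (x - l) <= r (x - u n) + r (l - u n).
  rewrite -lecR rmorphD /= -!rE [X in _ <= _ + X]distrC.
  by apply: le_trans (ler_normD _ _); rewrite addrA subrK.
by lra.
Qed.

Definition orthogonal_projection K x : H :=
  xget 0 [set p | K p /\ forall k, K k -> inner (x - p) k = 0].

Lemma orthogonal_projectionP K : closed_subspace K -> forall x,
  K (orthogonal_projection K x) /\
  forall k, K k -> inner (x - orthogonal_projection K x) k = 0.
Proof.
move=> Kcl x; have [k0 Kk0 k0P] := nearest_point K x Kcl.
case: Kcl => _ Klin _.
rewrite /orthogonal_projection; case: xgetP => [p _ //|/(_ k0) []].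
split=> // k Kk; have [->|k_neq0] := eqVneq k 0; first by rewrite inner0r.
(* Moving [k0] optimally along [k] would shorten the squared distance by
   [|inner (x - k0) k| ^+ 2 / |k| ^+ 2], so this quantity vanishes. *)
have /k0P : K ((inner (x - k0) k / `|k| ^+ 2) *: k + k0) by exact: Klin.
rewrite opprD addrA addrAC -(@ler_pXn2r _ 2) // ?nnegrE //.
rewrite sqrnorm_sub_line // lerDl oppr_ge0.
rewrite pmulr_lle0 ?invr_gt0 ?exprn_gt0 ?normr_gt0 //.
by rewrite real_exprn_even_le0 ?normr_real //= normr_eq0 => /eqP.
Qed.

Lemma orthogonal_projection_eq K x p : closed_subspace K -> K p ->
  (forall k, K k -> inner (x - p) k = 0) -> orthogonal_projection K x = p.
Proof.
move=> Kcl Kp pP; have [Kq qP] := orthogonal_projectionP K Kcl x.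
set q := orthogonal_projection K x in Kq qP *.
have Kpq : K (q - p).
  by case: Kcl => _ Klin _; rewrite addrC -scaleN1r; exact: Klin.
apply/eqP; rewrite -subr_eq0; apply/eqP/inner_eq0.
have {1}-> : q - p = (x - p) - (x - q) by rewrite opprB [RHS]addrC addrA subrK.
by rewrite innerBl pP ?qP ?subrr.
Qed.

End OrthogonalProjection.

(** * Bounded operators, Riesz representation and adjoints *)

Section BoundedOperators.
Context {R : realType} {H : hilbertType R}.
Implicit Types (A P Q T S X Y : H -> H) (x y : H).

Lemma bounded_opP {T} : bounded_op T ->
  forall (a : R[i]) x y, T (a *: x + y) = a *: T x + T y.
Proof. by case. Qed.

Lemma bounded_opD {T} : bounded_op T -> {morph T : x y / x + y}.
Proof. by move=> bT x y; have := bounded_opP bT 1 x y; rewrite !scale1r. Qed.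

Lemma bounded_op0 {T} : bounded_op T -> T 0 = 0.
Proof.
by move=> bT; apply: (addrI (T 0)); rewrite -(bounded_opD bT) !addr0.
Qed.

Lemma bounded_opZ {T} : bounded_op T ->
  forall (a : R[i]) x, T (a *: x) = a *: T x.
Proof.
move=> bT a x; have := bounded_opP bT a x 0.
by rewrite (bounded_op0 bT) !addr0.
Qed.

Lemma bounded_opB {T} : bounded_op T -> {morph T : x y / x - y}.
Proof.
by move=> bT x y; rewrite addrC -scaleN1r (bounded_opP bT) scaleN1r addrC.
Qed.

Lemma bounded_op_ge0 {T} : bounded_op T ->
  exists2 c : R[i], 0 <= c & forall x, `|T x| <= c * `|x|.
Proof.
move=> [_ [c cP]]; exists `|c| => // x.
rewrite -[`|x|]normr_id -normrM ger0_norm //.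
exact: le_trans (cP x).
Qed.

Lemma closed_subspace_ker_form T y :
  bounded_op T -> closed_subspace [set x | inner (T x) y = 0].
Proof.
move=> bT; split=> /=.
- by rewrite (bounded_op0 bT) inner0l.
- move=> a u v u0 v0.
  by rewrite (bounded_opP bT) innerDl innerZl u0 v0 mulr0 addr0.
move=> x xP; have [c c0 cP] := bounded_op_ge0 bT.
have le_e (e : R[i]) : 0 < e -> `|inner (T x) y| <= (c * `|y|) * e.
  move=> /xP [k /= k0 lt_e].
  rewrite -[inner _ _]subr0 -k0 -innerBl -(bounded_opB bT).
  apply: le_trans (cauchy_schwarz _ _) _; rewrite mulrAC ler_wpM2r //.
  by apply: le_trans (cP _) _; rewrite ler_wpM2l // ltW.
apply/eqP; rewrite -normr_eq0; apply/negPn/negP => n0.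
have n_gt0 : 0 < `|inner (T x) y| by rewrite lt_def n0 /=.
have c1 : 0 < c * `|y| + 1 by rewrite ltr_wpDl // mulr_ge0.
(* This choice of [e] yields [c * |y| + 1 <= c * |y|]; the summand 1 keeps the denominator
   positive. *)
have := le_e (`|inner (T x) y| / (c * `|y| + 1)) (divr_gt0 n_gt0 c1).
rewrite mulrCA ler_pMr // ler_pdivlMr // mul1r -subr_ge0.
by rewrite opprD addrA subrr sub0r oppr_ge0 ler10.
Qed.

(** The kernel [K] of the functional [f] is closed. If it is proper, [f] is determined by its value
    at one nonzero [u] orthogonal to [K], since every [x] differs from a multiple of [u] by an
    element of [K]. *)
Lemma riesz_form T y : bounded_op T ->
  exists z, forall x, inner (T x) y = inner x z.
Proof.
move=> bT; set K := [set x | inner (T x) y = 0].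
have Kcl : closed_subspace K := closed_subspace_ker_form T y bT.
have [KT|] := pselect (forall x, K x).
  by exists 0 => x; rewrite KT inner0r.
move=> /existsNP [x0 nKx0].
have [Kp pP] := orthogonal_projectionP K Kcl x0.
set u := x0 - orthogonal_projection K x0 in pP.
pose f x := inner (T x) y.
have fB a x : f (x - a *: u) = f x - a * f u.
  by rewrite /f (bounded_opB bT) (bounded_opZ bT) innerBl innerZl.
have fu0 : f u != 0.
  apply/eqP => fu; apply: nKx0.
  have u0 : u = 0 by apply/inner_eq0/pP.
  by move/eqP: u0; rewrite subr_eq0 => /eqP ->.
have uu0 : inner u u != 0.
  apply: contra_neq fu0 => /inner_eq0 ->.
  by rewrite /f (bounded_op0 bT) inner0l.
(* The conjugate compensates for the conjugate-linearity of [inner] in its second argument. *)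
exists (Num.conj (f u / inner u u) *: u) => x.
rewrite innerZr conjCK -/(f x).
have Kx : K (x - (f x / f u) *: u) by rewrite /K /= -/(f _) fB divfK ?subrr.
have := pP _ Kx; rewrite innerC => /(congr1 Num.conj); rewrite conjCK rmorph0.
rewrite innerBl innerZl => /eqP; rewrite subr_eq0 => /eqP ->.
by field; rewrite uu0 fu0.
Qed.

Lemma adjointP T x y : bounded_op T -> inner (T x) y = inner x (adjoint T y).
Proof.
move=> bT; rewrite /adjoint; case: xgetP => [z _ /= -> //|].
by have [z zP] := riesz_form T y bT => /(_ z) /(_ zP).
Qed.

Lemma adjoint_eq T S : (forall x y, inner (T x) y = inner x (S y)) ->
  adjoint T = S.
Proof.
move=> TS; apply/funext => y; rewrite /adjoint.
case: xgetP => [z _ /= zP|/(_ (S y)) []//]; apply: inner_inj => x.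
by rewrite innerC -zP TS -innerC.
Qed.

Lemma inner_adjointl T x y : bounded_op T ->
  inner (adjoint T x) y = inner x (T y).
Proof. by move=> bT; rewrite innerC -adjointP // -innerC. Qed.

(* A self-adjoint operator between 0 and 1 kills the vectors on which its
   quadratic form vanishes: with [y = Y x], positivity at [x - y] gives
   [|y|^2 <= 0]. *)
Lemma effect_eq0 Y x : bounded_op Y ->
  (forall u v, inner (Y u) v = inner u (Y v)) ->
  (forall u, 0 <= inner (Y u) u) -> (forall u, inner (Y u) u <= `|u| ^+ 2) ->
  inner (Y x) x = 0 -> Y x = 0.
Proof.
move=> bY Ysym Y_ge0 Y_le x0.
have := Y_ge0 (x - Y x); rewrite (bounded_opB bY).
rewrite !(innerBl, innerBr) x0 sub0r (Ysym (Y x) x) -inner_norm => ge0.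
have : `|Y x| ^+ 2 <= 0.
  rewrite -oppr_ge0 -[- _](subrK (`|Y x| ^+ 2 - inner (Y (Y x)) (Y x))).
  by rewrite addr_ge0 // subr_ge0.
by rewrite real_exprn_even_le0 ?normr_real //= normr_eq0 => /eqP.
Qed.

(** Cancel [|S x|] in [|S x| ^+ 2 = inner (T (S x)) x <= |S x| * |x|]. *)
Lemma adjoint_contraction T S : (forall x y, inner (T x) y = inner x (S y)) ->
  (forall x, `|T x| <= `|x|) -> forall x, `|S x| <= `|x|.
Proof.
move=> TS Tc x; have [->|nz] := eqVneq (S x) 0; first by rewrite normr0.
rewrite -(@ler_pM2l _ `|S x|) ?normr_gt0 // -expr2 inner_norm -TS.
rewrite -[inner _ _]ger0_norm ?TS ?dnorm_ge0 // -TS.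
apply: le_trans (cauchy_schwarz _ _) _; exact: ler_wpM2r.
Qed.

End BoundedOperators.

(** * Orthogonal projections and the support projection of a vector state *)

Section Projections.
Context {R : realType} {H : hilbertType R}.
Implicit Types (P Q T X Y : H -> H) (K : set H) (M : set (H -> H)) (x y : H).

Definition is_projection P : Prop :=
  [/\ bounded_op P, forall x y, inner (P x) y = inner x (P y)
    & forall x, P (P x) = P x].

Lemma projection_form P x : is_projection P -> inner (P x) x = `|P x| ^+ 2.
Proof. by move=> [_ Psym PP]; rewrite inner_norm -Psym PP. Qed.

Lemma projection_sqrnorm P x : is_projection P ->
  `|x| ^+ 2 = `|P x| ^+ 2 + `|x - P x| ^+ 2.
Proof.
move=> [bP Psym PP]; rewrite -pythagoras; first by rewrite addrCA subrr addr0.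
by rewrite innerBr -Psym PP subrr.
Qed.

Lemma projection_contraction P x : is_projection P -> `|P x| <= `|x|.
Proof.
move=> pP; rewrite -(@ler_pXn2r _ 2) // ?nnegrE //.
by rewrite (projection_sqrnorm P x) // lerDl exprn_ge0.
Qed.

Lemma projection_compl P : is_projection P -> is_projection (idfun - P).
Proof.
move=> pP; have [bP Psym PP] := pP.
have -> : idfun - P = (fun x => x - P x) by [].
split=> [|x y|x] /=; last by rewrite (bounded_opB bP) PP subrr subr0.
  split=> [a x y|] /=.
    by rewrite (bounded_opP bP) opprD addrACA scalerBr.
  exists 1 => x; rewrite mul1r -(@ler_pXn2r _ 2) // ?nnegrE //.
  by rewrite (projection_sqrnorm P x) // lerDr exprn_ge0.
by rewrite innerBl innerBr Psym.
Qed.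

(** Antisymmetry of [op_le] on projections. As [Q] kills [x - Q x], equality of the forms makes [P]
    kill it too, so [P Q = P]; likewise [Q P = Q], and self-adjointness concludes. *)
Lemma projection_form_inj P Q : is_projection P -> is_projection Q ->
  (forall x, inner (P x) x = inner (Q x) x) -> P = Q.
Proof.
have absorb X Y : is_projection X -> is_projection Y ->
    (forall x, inner (X x) x = inner (Y x) x) -> forall x, X (Y x) = X x.
  move=> pX pY XY x; have [bX _ _] := pX; have [bY _ YY] := pY.
  apply/eqP; rewrite eq_sym -subr_eq0 -(bounded_opB bX) -normr_eq0 -sqrf_eq0.
  rewrite -projection_form // XY projection_form //.
  by rewrite (bounded_opB bY) YY subrr normr0 expr0n.
move=> pP pQ PQ; have [_ Psym _] := pP; have [_ Qsym _] := pQ.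
apply/funext => x; apply: inner_inj => y.
rewrite -(absorb P Q pP pQ PQ) Psym Qsym.
by rewrite (absorb Q P pQ pP) // -Qsym.
Qed.

Lemma orthogonal_projection_is_projection K : closed_subspace K ->
  is_projection (orthogonal_projection K).
Proof.
move=> Kcl; set E := orthogonal_projection K.
have EP := orthogonal_projectionP K Kcl.
have EK x : K (E x) := (EP x).1.
have Eorth x k : K k -> inner (x - E x) k = 0 := (EP x).2 k.
have [_ Klin _] := Kcl.
have Esym x y : inner (E x) y = inner x (E y).
  have := Eorth x _ (EK y); have := Eorth y _ (EK x).
  rewrite innerC => /(congr1 Num.conj); rewrite conjCK rmorph0.
  rewrite innerBr innerBl => /eqP; rewrite subr_eq0 => /eqP ->.
  by move/eqP; rewrite subr_eq0 => /eqP ->.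
split=> //; last first.
  by move=> x; apply: orthogonal_projection_eq => // k Kk; rewrite subrr inner0l.
split=> [a x y|].
  apply: orthogonal_projection_eq => // [|k Kk]; first exact: Klin.
  rewrite opprD addrACA -scalerBr innerDl innerZl.
  by rewrite !Eorth // mulr0 addr0.
exists 1 => x; rewrite mul1r -(@ler_pXn2r _ 2) // ?nnegrE //.
rewrite -[in leRHS](subrK (E x) x) pythagoras; last exact: Eorth.
by rewrite lerDr exprn_ge0.
Qed.

(** If [p] is the projection of [x], then [T p] is in [K], and [T (x - p)] is orthogonal to [K]
    because [adjoint T] preserves [K]; so [T p] is the projection of [T x]. *)
Lemma orthogonal_projection_comm K T : closed_subspace K -> bounded_op T ->
  (forall x, K x -> K (T x)) -> (forall x, K x -> K (adjoint T x)) ->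
  orthogonal_projection K \o T = T \o orthogonal_projection K.
Proof.
move=> Kcl bT KT KTa; apply/funext => x /=.
have [Kp pP] := orthogonal_projectionP K Kcl x.
apply: orthogonal_projection_eq => // [|k Kk]; first exact: KT.
by rewrite -(bounded_opB bT) adjointP // pP //; apply: KTa.
Qed.

Lemma projectionsE M X : von_neumann_algebra M ->
  projections M X <-> M X /\ is_projection X.
Proof.
move=> vN; split=> [[MX XX aX]|[MX [bX Xsym XX]]].
  split=> //; have bX := vna_bounded vN MX; split=> // [x y|x].
    by rewrite adjointP // aX.
  by rewrite -[in RHS]XX.
by split=> //; [apply/funext => x /=; rewrite XX|exact: adjoint_eq].
Qed.

Lemma von_neumann_algebraB M X Y : von_neumann_algebra M ->
  M X -> M Y -> M (X - Y).
Proof.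
by move=> vN MX MY; rewrite -scaleN1r; apply: vna_add => //; apply: vna_scale.
Qed.

Lemma von_neumann_algebra_sum M d (X : 'I_d -> H -> H) :
  von_neumann_algebra M -> (forall i, M (X i)) -> M (\sum_(i < d) X i).
Proof.
move=> vN MX; apply: (big_ind M) => //; last exact: vna_add.
by rewrite -[0](scale0r (idfun : H -> H)); apply: vna_scale => //; apply: vna_id.
Qed.

(* The support projection is the projection onto the closed subspace of the
   vectors killed by every operator of [M] that kills [psi]. *)
Lemma support_projectionP M psi P : von_neumann_algebra M ->
  is_support_projection M (marginal psi) P ->
  [/\ M P, is_projection P, P psi = psi
    & forall X, M X -> X psi = 0 -> forall x, X (P x) = 0].
Proof.
move=> vN [Q [projQ Q_ub Q_lub] PE].
pose K := [set x | forall X, M X -> X psi = 0 -> X x = 0].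
have Kcl : closed_subspace K.
  split=> [X MX _|a x y Kx Ky X MX X0|x xP X MX X0].
  - exact: bounded_op0 (vna_bounded vN MX).
  - by rewrite (bounded_opP (vna_bounded vN MX)) Kx // Ky // scaler0 addr0.
  apply: inner_inj => y; rewrite inner0l.
  have [_ _] := closed_subspace_ker_form X y (vna_bounded vN MX); apply.
  move=> e /xP [k Kk lt_e]; exists k => //=.
  by rewrite Kk // inner0l.
pose E := orthogonal_projection K.
have EK x : K (E x) := (orthogonal_projectionP K Kcl x).1.
have [bE Esym EE] : is_projection E :=
  orthogonal_projection_is_projection K Kcl.
(* By the bicommutant property it is enough that [E] commutes with each [T] in the commutant. Both
   [T] and [adjoint T] preserve [K], since [T] commutes with [X] and with [adjoint X]. *)
have ME : M E.
  rewrite -(vna_bicommutant vN); split=> // T [bT TM].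
  have TMx X x : M X -> T (X x) = X (T x).
    by move=> /TM; move/(congr1 (fun f : H -> H => f x)).
  apply: orthogonal_projection_comm => // x Kx X MX X0.
    by rewrite -(TMx X) // Kx // (bounded_op0 bT).
  have bX := vna_bounded vN MX.
  apply: inner_inj => y; rewrite inner0l adjointP // inner_adjointl //.
  by rewrite (TMx (adjoint X) y (vna_adjoint vN MX)) -adjointP // Kx // inner0l.
have Epsi : E psi = psi.
  by apply: orthogonal_projection_eq => // k _; rewrite subrr inner0l.
have pF : is_projection (idfun - E).
  exact/projection_compl/orthogonal_projection_is_projection.
have projF : projections M (idfun - E).
  apply/projectionsE => //; split=> //.
  by apply: von_neumann_algebraB => //; apply: vna_id.
have [MQ pQ] : M Q /\ is_projection Q by apply/projectionsE.
(* The projection [1 - E] is itself in the family, hence below [Q]. Conversely a projection [X] of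
   the family kills [psi], so [X E = 0] and [X = X (1 - E)] is below [1 - E]; hence so is [Q]. *)
have QE : Q = idfun - E.
  apply: projection_form_inj => // x; apply: le_anti; apply/andP; split; last first.
    apply: Q_ub; split=> //=.
    by rewrite /marginal !fctE /= Epsi subrr inner0l.
  apply: Q_lub => // X [/projectionsE [] // MX pX] /= X0 {}x.
  have [bX Xsym XX] := pX.
  have Xpsi : X psi = 0.
    by apply: inner_eq0; rewrite -inner_norm -projection_form.
  have -> : inner (X x) x = `|X (x - E x)| ^+ 2.
    by rewrite projection_form // (bounded_opB bX) EK // subr0.
  rewrite projection_form // !fctE /= ler_pXn2r ?nnegrE //.
  exact: projection_contraction.
have -> : P = E by rewrite PE QE opprB addrC subrK.
by split=> // X MX X0 x; apply: EK.
Qed.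

End Projections.

(** * Compressions of the first column by the support projection *)

Section Embezzlement.
Context {R : realType} {H : hilbertType R} (M : set (H -> H)) (psi : H).
Context (P : H -> H) {d : nat} (T : 'I_d -> H -> H) (alpha : 'I_d -> R).
Context (vN : von_neumann_algebra M) (psi_unit : `|psi| = 1).
Context (P_supp : is_support_projection M (marginal psi) P).
Context (MT : forall i, M (T i)).
Context (T_contr : forall x, \sum_(i < d) `|T i x| ^+ 2 <= `|x| ^+ 2).

Implicit Types (X Y S : H -> H) (x y : H).

Let bT i : bounded_op (T i) := vna_bounded vN (MT i).
Let MP : M P. Proof. by have [] := support_projectionP M psi P vN P_supp. Qed.
Let pP : is_projection P.
Proof. by have [] := support_projectionP M psi P vN P_supp. Qed.
Let bP : bounded_op P. Proof. by case: pP. Qed.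
Let Psym x y : inner (P x) y = inner x (P y). Proof. by case: pP. Qed.
Let PP x : P (P x) = P x. Proof. by case: pP. Qed.
Let Ppsi : P psi = psi.
Proof. by have [] := support_projectionP M psi P vN P_supp. Qed.
Let P_faithful X : M X -> X psi = 0 -> forall x, X (P x) = 0.
Proof. by have [_ _ _] := support_projectionP M psi P vN P_supp; apply. Qed.

Lemma adjoint_compress i :
  adjoint (P \o adjoint (T i) \o P) = P \o T i \o P.
Proof.
by apply: adjoint_eq => x y /=; rewrite Psym inner_adjointl // Psym.
Qed.

Lemma marginal_adjoint S X Y : bounded_op S ->
  marginal psi (adjoint S \o X \o Y) = inner (X (Y psi)) (S psi).
Proof. by move=> bS; rewrite /marginal /= inner_adjointl. Qed.

Lemma marginal_compress X i j :
  marginal psi (P \o adjoint (T i) \o P \o X \o (P \o T j \o P)) =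
  inner (X (P (T j psi))) (P (T i psi)).
Proof. by rewrite /marginal /= Psym inner_adjointl // Psym Ppsi. Qed.

(** * From exact embezzlement to Cuntz isometries *)

Section FromEmbezzlement.
Context (alpha_gt0 : forall i, 0 < alpha i).
Context (alpha_sum : \sum_(i < d) alpha i ^+ 2 = 1).
Context (T_state : forall X, M X -> forall i j,
  inner (X (T j psi)) (T i psi) =
  (i == j)%:R * (alpha i)%:C ^+ 2 * inner (X psi) psi).

Lemma compress_range i x : P (T i (P x)) = T i (P x).
Proof.
have pF := projection_compl P pP.
have MF : M (idfun - P) by apply: von_neumann_algebraB => //; apply: vna_id.
apply/esym/eqP; rewrite -subr_eq0; apply/eqP.
apply: (P_faithful ((idfun - P) \o T i)); first exact: vna_mul.
apply/eqP; rewrite -normr_eq0 -sqrf_eq0 /= -projection_form //.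
by rewrite T_state // !fctE /= Ppsi subrr inner0l mulr0.
Qed.

Let Z : H -> H := \sum_(i < d) (adjoint (T i) \o T i).

Let ZE x : Z x = \sum_(i < d) adjoint (T i) (T i x).
Proof. by rewrite /Z fct_sumE. Qed.

Let inner_Z x y : inner (Z x) y = \sum_(i < d) inner (T i x) (T i y).
Proof.
by rewrite ZE inner_suml; apply: eq_bigr => i _; rewrite inner_adjointl.
Qed.

(** Contractivity puts [1 - Z] between 0 and 1, and its value in the state is
    [1 - \sum_i alpha_i ^+ 2 = 0]. Hence it kills [psi], and then the range of [P]. *)
Lemma column_isometry x : \sum_(i < d) adjoint (T i) (T i (P x)) = P x.
Proof.
rewrite -ZE; apply/esym/eqP; rewrite -subr_eq0; apply/eqP.
have MY : M (idfun - Z).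
  apply: von_neumann_algebraB => //; first exact: vna_id.
  apply: von_neumann_algebra_sum => // i.
  by apply: vna_mul => //; apply: vna_adjoint.
apply: (P_faithful _ MY).
have Z_form u : inner (Z u) u = \sum_(i < d) `|T i u| ^+ 2.
  by rewrite inner_Z; apply: eq_bigr => i _; rewrite inner_norm.
apply: effect_eq0 => [|u v|u|u|]; first exact: vna_bounded MY.
- rewrite !fctE /= innerBl innerBr inner_Z [inner u (Z v)]innerC inner_Z.
  by rewrite rmorph_sum; congr (_ - _); apply: eq_bigr => i _; exact: innerC.
- by rewrite !fctE /= innerBl -inner_norm Z_form subr_ge0.
- rewrite !fctE /= innerBl -inner_norm Z_form gerBl sumr_ge0 // => i _.
  by rewrite exprn_ge0.
rewrite !fctE /= innerBl inner_Z.
rewrite (eq_bigr (fun i => (alpha i ^+ 2)%:C)); last first.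
  move=> i _; rewrite (T_state idfun) ?eqxx ?mul1r //; last exact: vna_id.
  by rewrite -inner_norm psi_unit expr1n mulr1 rmorphXn.
by rewrite -rmorph_sum alpha_sum -inner_norm psi_unit expr1n subrr.
Qed.

Let V i : H -> H := P \o adjoint (T i) \o P.
Let W i : H -> H := P \o T i \o P.

Let VW_adj i x y : inner (V i x) y = inner x (W i y).
Proof. by rewrite /V /W /= Psym inner_adjointl // Psym. Qed.

Let WV_adj i x y : inner (W i x) y = inner x (V i y).
Proof. by rewrite innerC -VW_adj -innerC. Qed.

Let MV i : M (V i). Proof. by do ?[apply: vna_mul => //]; apply: vna_adjoint. Qed.
Let MW i : M (W i). Proof. by do ?[apply: vna_mul => //]. Qed.

Let VW_state X i j : M X -> inner (X (W j psi)) (W i psi) =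
  (i == j)%:R * (alpha i)%:C ^+ 2 * inner (X psi) psi.
Proof. by move=> MX; rewrite /W /= !compress_range Ppsi T_state. Qed.

Lemma cuntz_sum x : \sum_(i < d) V i (W i x) = P x.
Proof.
rewrite -[in RHS]PP -[in RHS](column_isometry x).
rewrite (big_morph P (bounded_opD bP) (bounded_op0 bP)).
by apply: eq_bigr => i _; rewrite /V /W /= PP compress_range.
Qed.

Let W_contraction i x : `|W i x| <= `|x|.
Proof.
apply: le_trans (projection_contraction P x pP).
rewrite -(@ler_pXn2r _ 2) // ?nnegrE // /W /= compress_range.
apply: le_trans (T_contr (P x)).
by rewrite (bigD1 i) //= lerDl sumr_ge0 // => j _; rewrite exprn_ge0.
Qed.

(* Evaluating the state on [V i W i (sum_j V j W j)] in two ways gives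
   [alpha_i^2 = alpha_i^2 omega(W i V i)]. *)
Let state_WV i : inner (W i (V i psi)) psi = 1.
Proof.
have a0 : (alpha i)%:C ^+ 2 != 0 :> R[i].
  rewrite expf_neq0 // -(rmorph0 (real_complex R)).
  by rewrite (inj_eq (@complexI R)) gt_eqF.
apply: (mulfI a0); rewrite mulr1.
have e1 : inner (W i psi) (W i psi) = (alpha i)%:C ^+ 2.
  rewrite (VW_state idfun) ?eqxx ?mul1r; last exact: vna_id.
  by rewrite -inner_norm psi_unit expr1n mulr1.
rewrite -[in RHS]e1 -[X in _ = inner (W i X) _]Ppsi -cuntz_sum.
rewrite (big_morph (W i) (bounded_opD (vna_bounded vN (MW i)))
  (bounded_op0 (vna_bounded vN (MW i)))) inner_suml.
have e2 j : inner (W i (V j (W j psi))) (W i psi) =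
    (i == j)%:R * (alpha i)%:C ^+ 2 * inner (W i (V j psi)) psi.
  by rewrite (VW_state (W i \o V j)) //; apply: vna_mul.
rewrite (bigD1 i) //= e2 eqxx mul1r big1 ?addr0 // => j ji.
by rewrite e2 eq_sym (negbTE ji) !mul0r.
Qed.

(** Same scheme as for the column: [1 - W_i V_i] lies between 0 and 1 because [V_i] is a
    contraction, and it vanishes in the state by [state_WV]. *)
Lemma cuntz_isometry i x : W i (V i x) = P x.
Proof.
have VP y : V i (P y) = V i y by rewrite /V /= PP.
have MY : M (idfun - (W i \o V i)).
  apply: von_neumann_algebraB => //; first exact: vna_id.
  exact: vna_mul.
rewrite -VP; apply/esym/eqP; rewrite -subr_eq0; apply/eqP.
apply: (P_faithful _ MY).
have form u : inner (W i (V i u)) u = `|V i u| ^+ 2.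
  by rewrite WV_adj inner_norm.
apply: effect_eq0 => [|u v|u|u|]; first exact: vna_bounded MY.
- by rewrite !fctE /= innerBl innerBr WV_adj VW_adj.
- rewrite !fctE /= innerBl -inner_norm form subr_ge0 ler_pXn2r ?nnegrE //.
  exact: (adjoint_contraction (W i)).
- by rewrite !fctE /= innerBl -inner_norm form gerBl exprn_ge0.
by rewrite !fctE /= innerBl state_WV -inner_norm psi_unit expr1n subrr.
Qed.

Lemma embezzlement_cuntz : cuntz_isometries M P V /\
  forall X, M X -> forall i j, marginal psi (V i \o X \o adjoint (V j)) =
    (i == j)%:R * (alpha i)%:C ^+ 2 * marginal psi X.
Proof.
split=> [|X MX i j]; last first.
  by rewrite /V adjoint_compress marginal_compress -(VW_state X) // /W /= Ppsi.
split=> [i|j|].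
- by exists (adjoint (T i)) => //; apply: vna_adjoint.
- by rewrite {1}/V adjoint_compress; apply/funext => x; exact: cuntz_isometry.
apply/funext => x; rewrite fct_sumE -cuntz_sum; apply: eq_bigr => i _.
by rewrite {2}/V adjoint_compress.
Qed.

End FromEmbezzlement.

(* The first column of [R] is a contraction while its compression by [P] is
   isometric on the range of [P], so nothing leaks out of that range. *)
Lemma cuntz_compress_range :
  cuntz_isometries M P (fun i => P \o adjoint (T i) \o P) ->
  forall i x, P (T i (P x)) = T i (P x).
Proof.
move=> [_ _ sumP] i x.
have sum_norm : \sum_(j < d) `|P (T j (P x))| ^+ 2 = `|P x| ^+ 2.
  rewrite -[RHS]projection_form // -[in RHS](congr1 (@^~ x) sumP).
  rewrite fct_sumE inner_suml.
  apply: eq_bigr => j _; rewrite adjoint_compress /= PP Psym inner_adjointl //.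
  by rewrite projection_form.
have leak_ge0 j : 0 <= `|T j (P x) - P (T j (P x))| ^+ 2 by rewrite exprn_ge0.
(* By Pythagoras, adding [|P x| ^+ 2], that is [sum_norm], gives the sum of the [|T j (P x)| ^+ 2],
   which [T_contr] bounds by [|P x| ^+ 2]. *)
have leak : \sum_(j < d) `|T j (P x) - P (T j (P x))| ^+ 2 <= 0.
  rewrite -(lerD2l (`|P x| ^+ 2)) addr0 -{1}sum_norm -big_split /=.
  rewrite -(eq_bigr _ (fun j _ => projection_sqrnorm P (T j (P x)) pP)).
  exact: T_contr.
apply/esym/eqP; rewrite -subr_eq0 -normr_eq0 -sqrf_eq0.
rewrite eq_le leak_ge0 andbT; apply: le_trans leak.
by rewrite (bigD1 i) //= lerDl sumr_ge0.
Qed.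

End Embezzlement.

Theorem theorem2p12 (R : realType) (d : nat) (d_ge2 : (2 <= d)%N)
    (alpha : 'I_d -> R)
    (alpha_noninc : forall i j : 'I_d, (i <= j)%N -> alpha j <= alpha i)
    (alpha_gt0 : forall i, 0 < alpha i)
    (alpha_sum : \sum_(i < d) alpha i ^+ 2 = 1)
    (H : hilbertType R) (M : set (H -> H)) (M_vN : von_neumann_algebra M)
    (psi : H) (psi_unit : `|psi| = 1)
    (P : H -> H) (P_supp : is_support_projection M (marginal psi) P)
    (Rm : 'M[H -> H]_d) (Rm_M : matrix_over M Rm) (Rm_contr : block_contraction Rm) :
  exactly_embezzles M (ltnW d_ge2) Rm psi alpha
  <->
  (let V := fun i : 'I_d => P \o adjoint (Rm i (Ordinal (ltnW d_ge2))) \o P in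
   cuntz_isometries M P V /\
   forall X, M X -> forall i j : 'I_d,
     marginal psi (V i \o X \o adjoint (V j)) =
     (i == j)%:R * (alpha i)%:C ^+ 2 * marginal psi X).
Proof.
set o := Ordinal (ltnW d_ge2); pose T i := Rm i o.
have MT i : M (T i) := Rm_M i o.
have bT i : bounded_op (T i) := vna_bounded M_vN (MT i).
have T_contr x : \sum_(i < d) `|T i x| ^+ 2 <= `|x| ^+ 2.
  (* A vector supported on coordinate 0 sees only the first column of the matrix. *)
  have := Rm_contr (fun j => if j == o then x else 0).
  rewrite [leRHS](bigD1 o) //= ?eqxx [X in _ + X]big1 => [|j /negbTE ->]; last first.
    by rewrite normr0 expr0n.
  rewrite addr0; congr (_ <= _); apply: eq_bigr => i _.
  rewrite (bigD1 o) //= ?eqxx big1 ?addr0 // => j /negbTE ->.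
  exact: bounded_op0 (vna_bounded M_vN (Rm_M i j)).
split=> [[_ _ _ embez]|/= [cuntz state]].
  apply: (embezzlement_cuntz M psi P T alpha) => // X MX i j.
  by rewrite -marginal_adjoint // embez.
split=> // X MX i j /=; rewrite -state // -/(T i) -/(T j).
(* At [psi = P psi] this gives [P (T i psi) = T i psi], so compressing by [P] does not change the
   marginal. *)
have range := cuntz_compress_range M psi P T M_vN P_supp MT T_contr cuntz.
have [_ _ Ppsi _] := support_projectionP M psi P M_vN P_supp.
rewrite marginal_adjoint // (adjoint_compress M psi P T M_vN P_supp MT).
rewrite (marginal_compress M psi P T M_vN P_supp MT).
by have := range i psi; have := range j psi; rewrite Ppsi => -> ->.
Qed.
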